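(* If $\mathcal H$ is positive definite, then for every $i=1,2,\dots,n$ the LIS-hyper-differential sensitivity $S_i=\|\mathcal P\mathcal H^{-1}\mathcal B\boldsymbol e_i\|_{W_{\boldsymbol z}}$ is given by $$S_i=\sqrt{\sum_{k=1}^r\sum_{j=1}^r\left(\frac{\boldsymbol v_j^T\mathcal B\boldsymbol e_i}{1+\lambda_j}\right)\left(\frac{\boldsymbol v_k^T\mathcal B\boldsymbol e_i}{1+\lambda_k}\right)\boldsymbol v_k^TW_{\boldsymbol z}\boldsymbol v_j}.$$
   Context: Let $J(\boldsymbol z;\boldsymbol\theta)=M(\boldsymbol z,\boldsymbol\theta)+R(\boldsymbol z)$ with $\boldsymbol z\in\mathbb R^m$, $\boldsymbol\theta\in\mathbb R^n$, where $M(\boldsymbol z,\boldsymbol\theta)=\frac12(F(\boldsymbol z,\boldsymbol\theta)-\boldsymbol d)^TW(F(\boldsymbol z,\boldsymbol\theta)-\boldsymbol d)$ is the data misfit ($F:\mathbb R^m\times\mathbb R^n\to\mathbb R^d$ the parameter-to-observable map, $\boldsymbol d\in\mathbb R^d$ data, $W$ symmetric positive definite) and $R:\mathbb R^m\to\mathbb R$ is a regularization function. $J$ is twice continuously differentiable in $(\boldsymbol z,\boldsymbol\theta)$, and the Hessians of $M$ and $R$ below exist and are symmetric. Fix $\boldsymbol z^\star\in\mathbb R^m$ and $\overline{\boldsymbol\theta}\in\mathbb R^n$. All of the following are evaluated at $(\boldsymbol z^\star,\overline{\boldsymbol\theta})$: - $\mathcal H_M=\nabla^2_{\boldsymbol z,\boldsymbol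 z}M$ and $\mathcal H_R=\nabla^2_{\boldsymbol z,\boldsymbol z}R$ are the misfit and regularization Hessians, with $\mathcal H_R$ symmetric positive definite; - $\mathcal H=\nabla_{\boldsymbol z,\boldsymbol z}J=\mathcal H_M+\mathcal H_R\in\mathbb R^{m\times m}$; - $\mathcal B=\nabla_{\boldsymbol z,\boldsymbol\theta}J\in\mathbb R^{m\times n}$ is the Jacobian of $\nabla_{\boldsymbol z}J$ with respect to $\boldsymbol\theta$. Let $\lambda_1\ge\dots\ge\lambda_m$ be the generalized eigenvalues, $\mathcal H_M\boldsymbol v_j=\lambda_j\mathcal H_R\boldsymbol v_j$, with eigenvectors $\boldsymbol v_1,\dots,\boldsymbol v_m$ that are $\mathcal H_R$-orthonormal ($\boldsymbol v_j^T\mathcal H_R\boldsymbol v_k=\delta_{jk}$). Fix $r$ such that $\lambda_1,\dots,\lambda_r$ are positive. The projector onto the likelihood informed subspace (LIS) is $\mathcal P=\mathcal V\mathcal V^T\mathcal H_R$ with $\mathcal V=[\boldsymbol v_1,\dots,\boldsymbol v_r]$. $W_{\boldsymbol z}\in\mathbb R^{m\times m}$ is symmetric positive definite, $\|\boldsymbol x\|_{W_{\boldsymbol z}}=\sqrt{\boldsymbol x^TW_{\boldsymbol z}\boldsymbol x}$, and $\boldsymbol e_i$ is the $i$-th canonical basis vector of $\mathbb R^n$. *)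

(* Defs.v *)
From HB Require Import structures.
From mathcomp Require Import all_boot all_order all_algebra.
From mathcomp Require Import all_classical all_reals all_analysis.

Set Implicit Arguments.
Unset Strict Implicit.
Unset Printing Implicit Defensive.

Import Order.TTheory GRing.Theory Num.Theory.
Import numFieldNormedType.Exports.

Local Open Scope classical_set_scope.
Local Open Scope ring_scope.

Section Matrices.
Variable R : realType.

Definition bilin n (x : 'cV[R]_n) (A : 'M[R]_n) (y : 'cV[R]_n) : R :=
  (x^T *m A *m y) 0 0.

(* Positivity of the quadratic form only; symmetry is stated as [symmetricmx]. *)
Definition posdef n (A : 'M[R]_n) : Prop :=
  forall x : 'cV[R]_n, x != 0 -> 0 < bilin x A x.

Definition wnorm n (W : 'M[R]_n) (x : 'cV[R]_n) : R := Num.sqrt (bilin x W x).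

Definition basis_vec n (i : 'I_n) : 'cV[R]_n := delta_mx i 0.

End Matrices.
Arguments basis_vec {R n} i.

Section Calculus.
Variable R : realType.

Definition gradient m (f : 'cV[R]_m -> R) (z : 'cV[R]_m) : 'cV[R]_m :=
  \col_i 'D_(basis_vec i) f z.

(* Column-vector convention, i.e. row i holds the partial derivatives of the
   i-th component; this is the transpose of the row-vector ['J] of derive.v. *)
Definition jacobian_mx m n (G : 'cV[R]_n -> 'cV[R]_m) (x : 'cV[R]_n) :
    'M[R]_(m, n) :=
  \matrix_(i < m, j < n) ('D_(basis_vec j) G x) i 0.

Definition hessian m (f : 'cV[R]_m -> R) (z : 'cV[R]_m) : 'M[R]_m :=
  jacobian_mx (gradient f) z.

(* ['D] is total, so existence of the second partial derivatives at [z] has to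
   be required separately. *)
Definition has_hessian m (f : 'cV[R]_m -> R) (z : 'cV[R]_m) : Prop :=
  (\forall y \near z, forall i : 'I_m, derivable f y (basis_vec i)) /\
  (forall j : 'I_m, derivable (gradient f) z (basis_vec j)).

(* nabla_{z,theta} f : the Jacobian in theta of nabla_z f. *)
Definition mixed_hessian m n (f : 'cV[R]_m -> 'cV[R]_n -> R)
    (z : 'cV[R]_m) (theta : 'cV[R]_n) : 'M[R]_(m, n) :=
  jacobian_mx (fun t => gradient (fun y => f y t) z) theta.

(* Joint C^2 regularity on R^m x R^n.  Continuity of each second directional
   derivative amounts to continuity of the second Frechet derivative because
   the domain is finite-dimensional. *)
Definition twice_continuously_differentiable m n
    (f : 'cV[R]_m * 'cV[R]_n -> R) : Prop :=
  [/\ forall p, differentiable f p,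
      forall u p, differentiable ('D_u f) p
    & forall u w, continuous ('D_w ('D_u f))].

End Calculus.

Section Problem.
Variables (R : realType) (m n : nat).

Definition misfit d (F : 'cV[R]_m -> 'cV[R]_n -> 'cV[R]_d) (data : 'cV[R]_d)
    (W : 'M[R]_d) (z : 'cV[R]_m) (theta : 'cV[R]_n) : R :=
  2^-1 * bilin (F z theta - data) W (F z theta - data).

Definition objective d (F : 'cV[R]_m -> 'cV[R]_n -> 'cV[R]_d)
    (data : 'cV[R]_d) (W : 'M[R]_d) (Reg : 'cV[R]_m -> R)
    (z : 'cV[R]_m) (theta : 'cV[R]_n) : R :=
  misfit F data W z theta + Reg z.

(* V V^T H_R, where V has columns v_1, ..., v_r. *)
Definition lis_projector r (HR : 'M[R]_m) (v : 'I_r -> 'cV[R]_m) : 'M[R]_m :=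
  let V := \matrix_(i < m, j < r) v j i 0 in V *m V^T *m HR.

Definition lis_sensitivity (P H : 'M[R]_m) (B : 'M[R]_(m, n)) (Wz : 'M[R]_m)
    (i : 'I_n) : R :=
  wnorm Wz (P *m invmx H *m B *m basis_vec i).

End Problem.

(* Main.v *)
(* By symmetry, v_j^T H = v_j^T H_M + v_j^T H_R = (1 + lambda_j) v_j^T H_R, hence
   v_j^T H_R H^-1 = v_j^T / (1 + lambda_j).  The projected sensitivity is thus
   the sum of the (v_j^T B e_i) / (1 + lambda_j) v_j, whose weighted norm is
   expanded by bilinearity. *)
Require Import Defs.
From mathcomp Require Import all_boot all_order all_algebra.
From mathcomp Require Import all_classical all_reals all_analysis.

Set Implicit Arguments.
Unset Strict Implicit.
Unset Printing Implicit Defensive.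

Import Order.TTheory GRing.Theory Num.Theory.
Import numFieldNormedType.Exports.
Local Open Scope ring_scope.

Lemma symmetricmxE (R : realType) n (A : 'M[R]_n) :
  A \is symmetricmx -> A^T = A.
Proof.
(* [symmetricmx] is the Hermitian predicate with sign exponent 0 and the identity as conjugation;
   both decorations have to be cleared. *)
rewrite qualifE /= => /eqP {2}->.
by rewrite expr0 scale1r map_mx_id.
Qed.

(** A nonzero x with A x = 0 would make the form x^T A x vanish. Since [kermx] is a left kernel, the
    argument passes to A^T, whose row kernel is the column kernel of A. *)
Lemma posdef_unitmx (R : realType) n (A : 'M[R]_n) : posdef A -> A \in unitmx.
Proof.
move=> Apos; rewrite -unitmx_tr -row_free_unit -kermx_eq0.
apply/eqP/row_matrixP => i; rewrite row0; apply/eqP/negPn/negP => xn0.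
set x := row i _ in xn0.
have xA : A *m x^T = 0.
  apply: trmx_inj; rewrite trmx_mul trmxK trmx0.
  by apply/sub_kermxP; rewrite row_sub.
have := Apos x^T; rewrite /bilin -mulmxA xA mulmx0 mxE ltxx.
by rewrite -trmx0 (inj_eq trmx_inj) => /(_ xn0).
Qed.

(** ['D] is additive only where both derivatives exist, so the gradient of the sum is known to split
    only near z. This is enough, since a derivative at z depends only on the germ there. *)
Lemma derive_gradientD (R : realType) m (f g : 'cV[R]_m -> R)
    (z u : 'cV[R]_m) :
  (\forall y \near z, forall i : 'I_m, derivable f y (basis_vec i)) ->
  (\forall y \near z, forall i : 'I_m, derivable g y (basis_vec i)) ->
  derivable (gradient f) z u -> derivable (gradient g) z u ->
  'D_u (gradient (fun y => f y + g y)) z =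
  'D_u (gradient f) z + 'D_u (gradient g) z.
Proof.
move=> df dg ddf ddg; apply/esym; apply: (etrans (esym (deriveD ddf ddg))).
apply: near_eq_derive; apply: filterS2 df dg => y dfy dgy; apply/colP => k.
(* [rewrite mxE] would make unification unfold ['D] and diverge in practice. *)
apply: (etrans (mxE _ _ _ _)).
have -> : gradient f y k 0 = 'D_(basis_vec k) f y by exact: mxE.
have -> : gradient g y k 0 = 'D_(basis_vec k) g y by exact: mxE.
apply: (etrans (esym (deriveD (dfy k) (dgy k)))).
by apply/esym; exact: mxE.
Qed.

Lemma hessianD (R : realType) m (f g : 'cV[R]_m -> R) (z : 'cV[R]_m) :
  has_hessian f z -> has_hessian g z ->
  hessian (fun y => f y + g y) z = hessian f z + hessian g z.
Proof.
move=> [df ddf] [dg ddg]; apply/matrixP => i j.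
apply: (etrans (mxE _ _ _ _)).
have E := derive_gradientD df dg (ddf j) (ddg j).
apply: (etrans (congr1 (fun x : 'cV_m => x i 0) E)).
apply: (etrans (mxE _ _ _ _)).
apply/esym; apply: (etrans (mxE _ _ _ _)); congr (_ + _); exact: mxE.
Qed.

Lemma bilin_sum (R : realType) n r (A : 'M[R]_n) (c : 'I_r -> R)
    (v : 'I_r -> 'cV[R]_n) :
  bilin (\sum_k c k *: v k) A (\sum_j c j *: v j) =
  \sum_k \sum_j c j * c k * bilin (v k) A (v j).
Proof.
rewrite /bilin [_^T]linear_sum !mulmx_suml summxE; apply: eq_bigr => k _.
rewrite mulmx_sumr summxE; apply: eq_bigr => j _ /=.
rewrite [(_ *: _)^T]linearZ /= -!scalemxAl -scalemxAr !mxE mulrA.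
by rewrite [c k * c j]mulrC.
Qed.

(** V^T H_R x lists the coefficients, and V combines the v_j with them. *)
Lemma lis_projector_mul (R : realType) m r (HR : 'M[R]_m)
    (v : 'I_r -> 'cV[R]_m) (x : 'cV[R]_m) :
  lis_projector HR v *m x = \sum_j bilin (v j) HR x *: v j.
Proof.
rewrite /lis_projector -!mulmxA; set V := \matrix_(_, _) _.
apply/colP => i; rewrite mxE summxE; apply: eq_bigr => j _.
rewrite !mxE mulrC /bilin -mulmxA; congr (_ * _).
by rewrite mxE; apply: eq_bigr => k _; rewrite !mxE.
Qed.

Lemma bilin_eigen_inv (R : realType) m (HM HR : 'M[R]_m) (l : R)
    (x y : 'cV[R]_m) :
  HM^T = HM -> HR^T = HR -> HM + HR \in unitmx -> 1 + l != 0 ->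
  HM *m x = l *: (HR *m x) ->
  bilin x HR (invmx (HM + HR) *m y) = (x^T *m y) 0 0 / (1 + l).
Proof.
move=> sM sR uH l0 ev.
have xH : x^T *m (HM + HR) = (1 + l) *: (x^T *m HR).
  rewrite mulmxDr -{1}sM -trmx_mul ev linearZ /= trmx_mul sR.
  by rewrite scalerDl scale1r addrC.
(* Inserting H H^-1 between x^T and y lets [xH] act on the left factor; the scalar 1 + l then
   cancels by [l0]. *)
have -> : x^T *m y = (1 + l) *: (x^T *m HR *m (invmx (HM + HR) *m y)).
  by rewrite scalemxAl -xH mulmxA mulmxK.
by rewrite [in RHS]mxE mulrC mulKf.
Qed.

(** The linear-algebra core, for arbitrary matrices in place of the Hessians: positivity enters only
    through invertibility of the sum and the nonzero denominators. *)
Lemma lis_sensitivityE (R : realType) m n r (HM HR Wz : 'M[R]_m)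
    (B : 'M[R]_(m, n)) (l : 'I_r -> R) (v : 'I_r -> 'cV[R]_m) (i : 'I_n) :
  HM^T = HM -> HR^T = HR -> HM + HR \in unitmx ->
  (forall j, 1 + l j != 0) ->
  (forall j, HM *m v j = l j *: (HR *m v j)) ->
  lis_sensitivity (lis_projector HR v) (HM + HR) B Wz i =
  Num.sqrt (\sum_(k < r) \sum_(j < r)
    (((v j)^T *m B *m basis_vec i) 0 0 / (1 + l j)) *
    (((v k)^T *m B *m basis_vec i) 0 0 / (1 + l k)) *
    bilin (v k) Wz (v j)).
Proof.
move=> sM sR uH l0 ev.
(* Reassociating makes the projector act on the single vector H^-1 (B e_i). *)
rewrite /lis_sensitivity /wnorm -2!mulmxA lis_projector_mul bilin_sum.
congr (Num.sqrt _).
have E j : bilin (v j) HR (invmx (HM + HR) *m (B *m basis_vec i)) =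
    ((v j)^T *m B *m basis_vec i) 0 0 / (1 + l j).
  by rewrite -mulmxA; exact: bilin_eigen_inv.
by apply: eq_bigr => k _; apply: eq_bigr => j _; rewrite !E.
Qed.

Theorem theorem3p1 (R : realType) (m n d : nat)
    (F : 'cV[R]_m -> 'cV[R]_n -> 'cV[R]_d) (data : 'cV[R]_d) (W : 'M[R]_d)
    (Reg : 'cV[R]_m -> R) (zs : 'cV[R]_m) (thetab : 'cV[R]_n)
    (Wz : 'M[R]_m) (lambda : 'I_m -> R) (v : 'I_m -> 'cV[R]_m)
    (r : nat) (hr : (r <= m)%N) :
  let M := misfit F data W in
  let J := objective F data W Reg in
  let HM := hessian (fun z => M z thetab) zs in
  let HR := hessian Reg zs in
  let H := hessian (fun z => J z thetab) zs in
  let B := mixed_hessian J zs thetab in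
  let lambda_ (j : 'I_r) := lambda (widen_ord hr j) in
  let v_ (j : 'I_r) := v (widen_ord hr j) in
  let P := lis_projector HR v_ in
  W \is symmetricmx -> posdef W ->
  twice_continuously_differentiable (fun p => J p.1 p.2) ->
  has_hessian (fun z => M z thetab) zs -> HM \is symmetricmx ->
  has_hessian Reg zs -> HR \is symmetricmx -> posdef HR ->
  (forall j k : 'I_m, (j <= k)%N -> lambda k <= lambda j) ->
  (forall j, HM *m v j = lambda j *: (HR *m v j)) ->
  (forall j k, bilin (v j) HR (v k) = (j == k)%:R) ->
  (forall j : 'I_r, 0 < lambda_ j) ->
  Wz \is symmetricmx -> posdef Wz ->
  posdef H ->
  forall i : 'I_n,
    lis_sensitivity P H B Wz i =
    Num.sqrt (\sum_(k < r) \sum_(j < r)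
      (((v_ j)^T *m B *m basis_vec i) 0 0 / (1 + lambda_ j)) *
      (((v_ k)^T *m B *m basis_vec i) 0 0 / (1 + lambda_ k)) *
      bilin (v_ k) Wz (v_ j)).
Proof.
move=> M J HM HR H B lambda_ v_ P _ _ _ hM sM hR sR _ _ ev _ lpos _ _ posH i.
(* At fixed [thetab], [objective] unfolds to misfit plus [Reg], so additivity of the Hessian applies
   by conversion. *)
have HE : H = HM + HR by exact: hessianD hM hR.
have uH : HM + HR \in unitmx by rewrite -HE; exact: posdef_unitmx posH.
rewrite HE; apply: lis_sensitivityE uH _ _.
- exact: symmetricmxE sM.
- exact: symmetricmxE sR.
(* The r retained eigenvalues are positive, hence 1 + [lambda_ j] > 0. *)
- by move=> j; rewrite gt_eqF // ltr_wpDr // ltW.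
- by move=> j; exact: ev.
Qed.
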